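(* Let $X$ be an infinite homogeneous compactum that is the union of finitely many countably tight subspaces. Then $|X| = \mathfrak{c}$.
   Context: A compactum is a compact Hausdorff space. A space $X$ is homogeneous if for all $x,y\in X$ there is a homeomorphism $h:X\to X$ with $h(x)=y$. A space $Y$ is countably tight if whenever $A\subset Y$ and $y\in\overline{A}$ (closure in $Y$) there is a countable $B\subset A$ with $y\in\overline{B}$; a subspace is countably tight if it is so in its subspace topology. $\mathfrak{c}=2^{\omega}$. *)

(* Defs.v *)
From mathcomp Require Import all_boot.
From mathcomp Require Import all_classical topology.

Set Implicit Arguments.
Unset Strict Implicit.
Unset Printing Implicit Defensive.

Local Open Scope classical_set_scope.

Definition homeomorphism (X Y : topologicalType) (h : X -> Y) : Prop :=
  continuous h /\
  exists g : Y -> X, [/\ continuous g, cancel h g & cancel g h].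

Definition homogeneous_space (X : topologicalType) : Prop :=
  forall x y : X, exists h : X -> X, homeomorphism h /\ h x = y.

Definition compactum (X : topologicalType) : Prop :=
  compact [set: X] /\ hausdorff_space X.

Definition countably_tight (Y : topologicalType) : Prop :=
  forall (A : set Y) (y : Y), closure A y ->
    exists B : set Y, [/\ B `<=` A, countable B & closure B y].

(* [set_type A] carries the initial topology of the inclusion, i.e. the usual
   subspace topology; the library's [subspace A] instead retopologizes all of X
   by isolating the points outside A. *)
Definition countably_tight_subspace (X : topologicalType) (A : set X) : Prop :=
  countably_tight (set_type A).

(* Main.v *)
(* The upper bound follows de la Vega's scheme: a homogeneous Hausdorff space has
   cardinality at most d(X)^pichi(X), so it suffices to find one point with a
   countable local pi-base and a dense set of size at most the continuum.

   Both rest on one device for finite covers by countably tight pieces [A j].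
   Suppose closed sets [H i], directed downwards, are such that no countable part
   of [D] accumulates at a point of their intersection, and that each [H i]
   contains a point of [D] lying outside [k] pieces whose traces on [D] accumulate
   at it.  That point lies in one more piece; fixing the pieces by pigeonhole and
   passing to a cluster point produces a point of the intersection with [k + 1]
   such pieces, since tightness keeps it out of each of them.  Iterating beyond
   the number of pieces is absurd.

   - If every nonempty closed G_delta needs more than continuum many points to be
     dense in it, such [H i] come from a free sequence of length omega_1.
   - If no point has a countable local pi-base, Shapirovskii's construction and
     the pressing down lemma give uncountably many independent pairs of disjoint
     closed sets, which carry free sequences of free sequences to any depth.
   - By homogeneity, small G_deltas cover X.  Sets closed under continuum many
     operations of countable arity then play the role of countably closed
     elementary submodels, and one that is not dense yields such [H i]. *)

Require Import Defs.
From mathcomp Require Import all_boot.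
From mathcomp Require Import all_classical topology.

Set Implicit Arguments.
Unset Strict Implicit.
Unset Printing Implicit Defensive.

Local Open Scope classical_set_scope.
Local Open Scope card_scope.

(** * Sets of size at most the continuum *)

Definition small (T : Type) := exists f : T -> set nat, injective f.

Lemma small_set_nat : small (set nat). Proof. by exists id. Qed.

Lemma small_injective (S T : Type) (f : S -> T) :
  injective f -> small T -> small S.
Proof. by move=> fI [g gI]; exists (g \o f); exact: inj_comp. Qed.

Lemma small_countType (T : countType) : small T.
Proof.
exists (fun t => [set pickle t]) => s t st.
by apply: (pcan_inj (@pickleK T)); have : [set pickle t] (pickle s) by rewrite -st.
Qed.

Lemma small_fun (A : countType) (T : Type) : small T -> small (A -> T).
Proof.
move=> [e eI]; exists (fun g => [set n | exists a m, n = pickle (a, m) /\ e (g a) m]).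
have sub g g' a : [set n | exists a m, n = pickle (a, m) /\ e (g a) m] =
    [set n | exists a m, n = pickle (a, m) /\ e (g' a) m] -> e (g a) `<=` e (g' a).
  move=> gg m gam; suff [b [k [/(pcan_inj (@pickleK _)) [-> ->]]]] :
    [set n | exists a m, n = pickle (a, m) /\ e (g' a) m] (pickle (a, m)) by [].
  by rewrite -gg; exists a, m.
move=> g g' gg; apply: funext => a; apply: eI.
by apply/seteqP; split; apply: sub.
Qed.

Lemma small_prod (S T : Type) : small S -> small T -> small (S * T).
Proof.
move=> [f fI] [g gI].
apply: (small_injective (f := fun p (b : bool) => if b then f p.1 else g p.2)).
  move=> [s t] [s' t'] /= E.
  by rewrite (fI _ _ (congr1 (@^~ true) E)) (gI _ _ (congr1 (@^~ false) E)).
exact: small_fun small_set_nat.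
Qed.

Lemma small_sum (S T : Type) : small S -> small T -> small (S + T).
Proof.
move=> [f fI] [g gI].
apply: (small_injective (f := fun (p : S + T) (b : bool) =>
  match p with inl s => if b then f s else set0
             | inr t => if b then g t else setT end)).
  move=> [s|t] [s'|t'] E; have /= := congr1 (@^~ true) E;
    have /= := congr1 (@^~ false) E.
  - by move=> _ /fI ->.
  - by move=> /= /seteqP[_ /(_ 0)] /(_ I).
  - by move=> /= /seteqP[/(_ 0)] /(_ I).
  - by move=> _ /gI ->.
exact: small_fun small_set_nat.
Qed.

Lemma small_option (T : Type) : small T -> small (option T).
Proof.
move=> sT; apply: (small_injective (f := fun o : option T =>
    if o is Some t then inl t else inr tt : T + unit)).
  by move=> [s|] [t|] // [->].
exact/small_sum/small_countType.
Qed.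

Lemma small_seq (T : Type) : small T -> small (seq T).
Proof.
move=> sT; apply: (small_injective (f := fun s i => nth None (map Some s) i)).
  elim=> [|a s IH] [|b t] //= E.
  - by have := congr1 (@^~ 0) E.
  - by have := congr1 (@^~ 0) E.
  - have [->] := congr1 (@^~ 0) E; congr (_ :: _).
    by apply: IH; apply: funext => i; exact: (congr1 (fun h => h i.+1) E).
exact/small_fun/small_option.
Qed.

Lemma small_surjective (T : Type) : small T -> T ->
  exists g : set nat -> T, forall t, exists c, g c = t.
Proof.
move=> [f fI] t0.
have /choice [g gP] : forall c, exists t, (exists s, f s = c) -> f t = c.
  by move=> c; case: (pselect (exists s, f s = c)) => [[s <-]|nc]; [exists s|exists t0].
by exists g => t; exists (f t); apply: fI; apply: gP; exists t.
Qed.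

Inductive tree (I : Type) := leaf of nat | node of I & (nat -> tree I).

(** Reads the label at the end of the path [s]; a leaf reached early answers for all longer paths.
    These labels determine the tree. *)
Fixpoint tree_code (I : Type) (t : tree I) (s : seq nat) : nat + option I :=
  match t, s with
  | leaf n, _ => inl n
  | node i _, [::] => inr (Some i)
  | node _ f, n :: s' => tree_code (f n) s'
  end.

Lemma small_tree (I : Type) : small I -> small (tree I).
Proof.
move=> sI; apply: (small_injective (f := @tree_code I)).
  elim=> [m|i f IH] [n|j g] E; have /= := congr1 (@^~ [::]) E => //.
    by move=> [->].
  move=> [->]; congr node; apply: funext => k; apply: IH.
  by apply: funext => s; exact: (congr1 (fun h => h (k :: s)) E).
apply: small_fun; apply: small_sum; first exact: small_countType.
exact: small_option.
Qed.

Fixpoint tree_eval (X I : Type) (F : I -> (nat -> X) -> X) (u : nat -> X)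
    (t : tree I) : X :=
  match t with
  | leaf n => u n
  | node i f => F i (fun n => tree_eval F u (f n))
  end.

(* A set closed under continuum many operations of countable arity is
   enumerated by the well-founded countably branching trees. *)
Lemma small_hull (X I : Type) (F : I -> (nat -> X) -> X) : small I ->
  exists Phi : (nat -> X) -> set nat -> X, forall u,
    range u `<=` range (Phi u) /\
    forall i v, range v `<=` range (Phi u) -> range (Phi u) (F i v).
Proof.
move=> /small_tree sI; have [g gs] := small_surjective sI (leaf I 0).
exists (fun u c => tree_eval F u (g c)) => u; split.
  by move=> _ [n _ <-]; have [c gc] := gs (leaf I n); exists c => //; rewrite gc.
move=> i v vP.
have /choice [w wP] : forall n, exists t, tree_eval F u t = v n.
  by move=> n; have [|c _ <-] := vP (v n); [exists n|exists (g c)].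
have [c gc] := gs (node i w); exists c => //; rewrite gc /=.
by congr (F i _); apply: funext.
Qed.

Lemma countable_range (T : Type) (B : set T) : countable B -> B !=set0 ->
  exists u : nat -> T, B = range u.
Proof.
move=> /countable_injP [f fI] [b Bb].
have /choice [u uP] : forall n, exists t, B t /\ forall s, B s -> f s = n -> t = s.
  move=> n; case: (pselect (exists2 s, B s & f s = n)) => [[s Bs sn]|nP].
    exists s; split=> // t Bt tn; apply: fI; rewrite ?inE //.
    by rewrite sn tn.
  by exists b; split=> // s Bs sn; case: nP; exists s.
exists u; apply/seteqP; split=> [s Bs|_ [n _ <-]]; last by case: (uP n).
by exists (f s) => //; case: (uP (f s)) => _ /(_ s Bs erefl).
Qed.

(** * Closed G_delta sets in compacta *)

Lemma countably_tight_subspaceP (X : topologicalType) (A : set X) :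
  countably_tight_subspace A ->
  forall D z, D `<=` A -> A z -> closure D z ->
  exists B, [/\ B `<=` D, countable B & closure B z].
Proof.
move=> At D z DA Az Dz.
have valA (x : X) (Ax : A x) : exists a : set_type A, set_val a = x.
  by exists (SigSub (mem_set Ax)).
have [a az] := valA z Az.
have [B [BD Bc Ba]] : exists B : set (set_type A),
    [/\ B `<=` set_val @^-1` D, countable B & closure B a].
  apply: At => V [_ [[O oO <-] /= Oa OV]].
  rewrite az in Oa; have [x [Dx Ox]] := Dz O (open_nbhs_nbhs (conj oO Oa)).
  by have [b bx] := valA x (DA x Dx); exists b; split; [rewrite /= bx|apply: OV; rewrite /= bx].
exists (set_val @` B); split.
- by move=> _ [b Bb <-]; exact: BD.
- exact: sub_countable (card_image_le _ _) Bc.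
- move=> V; rewrite -az => /(@initial_continuous _ _ (set_val : set_type A -> X) a) Va.
  by have [b [Bb Vb]] := Ba _ Va; exists (set_val b).
Qed.

Section Compactum.
Context (X : topologicalType).

(** The [H i] generate a proper filter, and a cluster point of it belongs to each closed [H i]. *)
Lemma directed_bigcap (Xc : compact [set: X]) (I : Type) (H : I -> set X) : I ->
  (forall i, closed (H i)) -> (forall i, H i !=set0) ->
  (forall i j, exists k, H k `<=` H i `&` H j) ->
  exists x, forall i, H i x.
Proof.
move=> i0 Hcl Hne Hdir.
have FF : ProperFilter (filter_from [set: I] H).
  apply: filter_from_proper => [|i _]; last exact: Hne.
  apply: filter_from_filter; first by exists i0.
  by move=> i j _ _; have [k kij] := Hdir i j; exists k.
have [|x [_ Fx]] := Xc _ FF; first by exists i0.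
exists x => i; apply: Hcl; move: Fx; rewrite clusterE => /(_ (H i)); apply.
by exists i.
Qed.

(** Otherwise the sets of points avoiding the interiors of listed neighbourhoods are nonempty,
    closed and directed under concatenation; a common point would avoid its own neighbourhood. *)
Lemma compact_finite_cover (Xc : compact [set: X]) (P : X -> set X) :
  (forall x, nbhs x (P x)) -> exists s : seq X, forall x,
    exists2 p, p \in s & P p x.
Proof.
move=> Pn; apply: contrapT => nos.
have [|s|s|s t|x xP] := @directed_bigcap Xc (seq X)
    (fun s => [set x | forall p, p \in s -> ~ (P p)° x]).
- exact: [::].
- rewrite (_ : [set x | _] = ~` \bigcup_(p in [set p | p \in s]) (P p)°).
    by apply: open_closedC; apply: bigcup_open => p _; exact: open_interior.
  by apply/seteqP; split=> x /= xs; [move=> [p ps /(xs p ps)]|move=> p ps Px; apply: xs; exists p].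
- apply: contrapT => s0; apply: nos; exists s => x.
  apply: contrapT => xs; apply: s0; exists x => p ps /interior_subset Ppx.
  by apply: xs; exists p.
- exists (s ++ t) => x /= xst.
  by split=> p ps; apply: xst; rewrite mem_cat ps ?orbT.
- by have := xP [:: x] x (mem_head _ _); apply; exact: Pn.
Qed.

Definition closed_Gdelta (F : set X) :=
  closed F /\ exists U : nat -> set X, (forall n, open (U n)) /\ F = \bigcap_n U n.

Lemma closed_GdeltaT : closed_Gdelta [set: X].
Proof.
split; first exact: closedT.
by exists (fun=> setT); split=> [_|]; [exact: openT|rewrite bigcapT].
Qed.

Lemma closed_Gdelta_bigcap (J : Type) (D : set J) (F : J -> set X) :
  countable D -> (forall i, D i -> closed_Gdelta (F i)) ->
  closed_Gdelta (\bigcap_(i in D) F i).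
Proof.
move=> Dc FD; split; first by apply: closed_bigI => i /FD[].
have [->|/set0P D0] := eqVneq D set0.
  by rewrite bigcap_set0; case: closed_GdeltaT.
have [u uD] := countable_range Dc D0.
have /choice [U UP] : forall n, exists U : nat -> set X,
    (forall m, open (U m)) /\ F (u n) = \bigcap_m U m.
  by move=> n; case: (FD (u n)) => //; rewrite uD; exists n.
exists (fun k => if unpickle k is Some p then U p.1 p.2 else setT); split.
  by move=> k; case: unpickle => [p|]; [case: (UP p.1)|exact: openT].
apply/seteqP; split=> x Fx.
  move=> k _; case: unpickle => [p|//].
  have := Fx (u p.1); case: (UP p.1) => _ -> /(_ _ p.2); apply=> //.
  by rewrite uD; exists p.1.
move=> i; rewrite uD => -[n _ <-]; case: (UP n) => _ -> m _.
by have := Fx (pickle (n, m)) I; rewrite pickleK.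
Qed.

Lemma closed_GdeltaI (F G : set X) :
  closed_Gdelta F -> closed_Gdelta G -> closed_Gdelta (F `&` G).
Proof.
move=> dF dG; rewrite (_ : F `&` G = \bigcap_(b in [set: bool]) (if b then F else G)).
  by apply: closed_Gdelta_bigcap => // -[].
apply/seteqP; split=> x; first by move=> [Fx Gx] [].
by move=> xFG; split; [exact: (xFG true)|exact: (xFG false)].
Qed.

Context (XX : compactum X).

Lemma compactum_shrink (C O : set X) : closed C -> open O -> C `<=` O ->
  exists V, [/\ open V, C `<=` V & closure V `<=` O].
Proof.
case: XX => Xc Xh Ccl Oo CO.
have [|V CV VO] := compact_normal Xh Xc Ccl (_ : set_nbhs C O).
  by move=> x Cx; apply: open_nbhs_nbhs; split=> //; exact: CO.
exists V°; split; first exact: open_interior.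
  by move=> x /CV.
exact: subset_trans (closureS (@interior_subset _ _)) VO.
Qed.

(** Normality allows [O] to be shrunk repeatedly around [C]. Each closure lies in the preceding open
    set, so the open sets and their closures have the same intersection. *)
Lemma closed_Gdelta_between (C O : set X) : closed C -> open O -> C `<=` O ->
  exists G, [/\ closed_Gdelta G, C `<=` G & G `<=` O].
Proof.
move=> Ccl Oo CO.
pose good V := open V /\ C `<=` V.
have /choice [f fP] : forall V, exists W, good V -> good W /\ closure W `<=` V.
  move=> V; case: (pselect (good V)) => [[Vo CV]|]; last by exists set0.
  by have [W [Wo CW WV]] := compactum_shrink Ccl Vo CV; exists W.
have fg n : good (iter n f O) by elim: n => //= n IH; case: (fP _ IH).
have fS n : closure (iter n.+1 f O) `<=` iter n f O.
  by case: (fP _ (fg n)).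
exists (\bigcap_n iter n f O); split.
- split; last by exists (fun n => iter n f O); split=> // n; case: (fg n).
  rewrite (_ : \bigcap_n _ = \bigcap_n closure (iter n f O)).
    by apply: closed_bigI => n _; exact: closed_closure.
  apply/seteqP; split=> x xP n _; first exact/subset_closure/xP.
  exact/fS/xP.
- by move=> x Cx n _; case: (fg n) => _; apply.
- by move=> x /(_ 0 I).
Qed.

Lemma compactum_closed1 (x : X) : closed [set x].
Proof. by case: XX => _ Xh; exact/accessible_closed_set1/hausdorff_accessible. Qed.

Lemma closed_Gdelta_nbhs (x : X) (O : set X) : open O -> O x ->
  exists G, [/\ closed_Gdelta G, G x & G `<=` O].
Proof.
move=> Oo Ox; have [|G [dG xG GO]] := closed_Gdelta_between (compactum_closed1 (x:=x)) Oo.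
  by move=> _ ->.
by exists G; split=> //; exact: xG.
Qed.

(** Serves the splitting step: a set not contained in [O] meets [Q], while finitely many of the [P]
    cover the space as [p] varies. *)
Lemma closed_Gdelta_pair (p : X) (O : set X) : open O -> O p ->
  exists P Q, [/\ closed_Gdelta P, closed_Gdelta Q, P `&` Q = set0,
    nbhs p P & ~` O `<=` Q].
Proof.
move=> Oo Op.
have [|V [Vo pV VO]] := compactum_shrink (compactum_closed1 (x:=p)) Oo.
  by move=> _ ->.
have [P [dP VP PO]] := closed_Gdelta_between (@closed_closure _ V) Oo VO.
have [|||Q [dQ OQ QP]] := @closed_Gdelta_between (~` O) (~` P).
- exact: open_closedC.
- by apply: closed_openC; case: dP.
- exact: subsetC.
exists P, Q; split=> //.
  by apply/seteqP; split=> // x [Px /QP].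
apply: filterS VP _; apply: filterS (@subset_closure _ _) _.
by apply: open_nbhs_nbhs; split=> //; exact: pV.
Qed.

End Compactum.

(** * Points reached from many pieces *)

Section Reached.
Context (X : topologicalType) (n : nat) (A : 'I_n -> set X).

(* The induction parameter of the whole proof: [z] lies outside at least [k]
   of the pieces although it is a limit of the part of [D] in each of them. *)
Definition reached (k : nat) (z : X) (D : set X) :=
  exists J : {set 'I_n}, (k <= #|J|)%N /\
    forall j, j \in J -> ~ A j z /\ closure (A j `&` D) z.

Lemma reached0 z D : reached 0 z D.
Proof. by exists finset.set0; split=> // j; rewrite inE. Qed.

Lemma reachedS k z D E : D `<=` E -> reached k z D -> reached k z E.
Proof.
move=> DE [J [Jk JP]]; exists J; split=> // j /JP[nA cl]; split=> //.
by apply: closureS cl; exact: setIS.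
Qed.

Lemma reached_unbounded z D : ~ reached n.+1 z D.
Proof.
by move=> [J [+ _]]; rewrite ltnNge (leq_trans (max_card _)) ?card_ord.
Qed.

(* Every limit point of the traces that belongs to [A j] would be a limit of a
   countable part of [D]. *)
Lemma reached_step (Xc : compact [set: X]) (Acover : \bigcup_i A i = [set: X])
    (Atight : forall i, countably_tight_subspace (A i))
    (k : nat) (I : Type) (H : I -> set X) (D : set X) : I ->
  (forall i, closed (H i)) ->
  (forall i j, exists l, H l `<=` H i `&` H j) ->
  (forall i, exists z, [/\ H i z, D z & reached k z D]) ->
  (forall B z, B `<=` D -> countable B -> (forall i, H i z) -> ~ closure B z) ->
  exists2 z, (forall i, H i z) & reached k.+1 z D.
Proof.
move=> i0 Hcl Hdir Hk HB.
(* A type [t] records a witness [t.1] for [reached] and one further piece [t.2] containing the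
   point; there are finitely many types. *)
pose Z (t : {set 'I_n} * 'I_n) := [set z | [/\ D z, A t.2 z, (k <= #|t.1|)%N &
  forall j, j \in t.1 -> ~ A j z /\ closure (A j `&` D) z]].
(* Pigeonhole: if each type were absent from some [H i], an [H l] inside all of these would contain
   no point of any type. *)
have [t tP] : exists t, forall i, H i `&` Z t !=set0.
  apply: contrapT => /forallNP nt.
  have /choice [f fP] : forall t, exists i, ~ (H i `&` Z t !=set0).
    by move=> t; apply/existsNP.
  have [l lP] : exists l, forall t, t \in enum [set: {set 'I_n} * 'I_n]%SET ->
      H l `<=` H (f t).
    elim: (enum _) => [|t s [l lP]]; first by exists i0.
    have [m mP] := Hdir l (f t); exists m => u; rewrite inE => /orP[/eqP->|us].
      by move=> x /mP[].
    by move=> x /mP[/(lP u us)].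
  have [z [lz Dz [J [Jk JP]]]] := Hk l.
  have [i _ Aiz] : (\bigcup_i A i) z by rewrite Acover.
  apply: (fP (J, i)); exists z; split; last by [].
  by apply: lP lz; rewrite mem_enum inE.
have [i|i|i j|z zP] := @directed_bigcap _ Xc I (fun i => closure (H i `&` Z t)) i0.
- exact: closed_closure.
- by have [x xP] := tP i; exists x; exact: subset_closure.
- have [l lP] := Hdir i j; exists l => x lx.
  by split; apply: closureS lx => y [/lP[] ? ? ?].
have Hz i : H i z by apply: Hcl; apply: closureS (zP i) => x [].
have AZ j : A j z -> ~ closure (A j `&` D) z.
  move=> Ajz.
  move=> /(countably_tight_subspaceP (Atight j) (@subIsetl _ _ _) Ajz)[B [BD Bc Bz]].
  by apply: (HB B z) => // x /BD[].
have clZ F : Z t `<=` F -> closure F z.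
  by move=> ZF; apply: closureS (zP i0) => x [_ /ZF].
exists z; first exact: Hz.
case: t tP clZ zP => J l tP clZ zP.
have [y [[_ [_ Aly Jk JP]] _]] := zP i0 _ filterT.
(* The index [l] is new: points of [Z (J, l)] lie in [A l] but in no piece indexed by [J]. *)
exists (l |: J)%SET; split.
  rewrite cardsU1; case: (boolP (l \in J)) => // lJ.
  by case: (JP l lJ).
move=> j; rewrite !inE => jlJ.
have clj : closure (A j `&` D) z.
  case/orP: jlJ => [/eqP->|jJ]; first by apply: clZ => x [].
  apply: (@closed_closure _ (A j `&` D)).
  by apply: clZ => x [_ _ _ /(_ _ jJ)[]].
by split=> // /AZ; apply.
Qed.

End Reached.

(** * An order of type omega_1 *)

Lemma countable_inj (S T : Type) (f : S -> T) (A : set S) (B : set T) :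
  injective f -> countable B -> f @` A `<=` B -> countable A.
Proof.
move=> fI /countable_injP[g gI] AB; apply/countable_injP; exists (g \o f) => a b.
by rewrite !inE => Aa Ab /gI E; apply/fI/E; rewrite inE; apply: AB; [exists a|exists b].
Qed.

Lemma uncountable_set_nat : ~ countable [set: set nat].
Proof.
move=> /countable_range[|u uT]; first by exists set0.
have [m _ mE] : range u [set n | ~ u n n] by rewrite -uT.
have nm : ~ u m m.
  by move=> um; have : [set n | ~ u n n] m by rewrite -mE.
by apply: (nm); rewrite mE.
Qed.

Record omega1_like (W : choiceType) (lt : W -> W -> Prop) : Prop := Omega1Like {
  lt_small : small W;
  lt_trans : forall a b c, lt a b -> lt b c -> lt a c;
  lt_wf : well_founded lt;
  lt_total : forall a b, [\/ lt a b, a = b | lt b a];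
  lt_initial : forall a, countable [set b | lt b a];
  lt_uncountable : ~ countable [set: W] }.

Lemma well_founded_lt_exists (T : choiceType) : exists lt : T -> T -> Prop,
  [/\ forall a b c, lt a b -> lt b c -> lt a c, well_founded lt &
    forall a b, [\/ lt a b, a = b | lt b a]].
Proof.
have [R Rwo] := wochoice.well_ordering_principle T.
have Rmin (P : set T) : P !=set0 -> exists2 m, P m & forall x, P x -> R m x.
  move=> [x Px]; have [|m [[mP mR] _]] := Rwo (mem P).
    by exists x; rewrite inE.
  exists m; first by move: mP; rewrite inE.
  by move=> y Py; apply: mR; rewrite inE.
have Ranti a b : R a b -> R b a -> a = b.
  move=> Rab Rba.
  have Rxx x : R x x by have [m -> ->] := Rmin [set x] (ex_intro _ x erefl).
  have [|m [_ mU]] := Rwo [pred x | (x == a) || (x == b)].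
    by exists a; rewrite inE eqxx.
  rewrite -(mU a) ?(mU b) //; split; rewrite ?inE ?eqxx ?orbT //;
    by move=> x; rewrite inE => /orP[] /eqP ->.
have Rtot a b : R a b \/ R b a.
  have [|m [->|->] mR] := Rmin [set x | x = a \/ x = b]; first by exists a; left.
    by left; apply: mR; right.
  by right; apply: mR; left.
exists (fun a b => R a b /\ a <> b); split.
- move=> a b c [ab nab] [bc nbc].
  have [|m [->|[->|->]] mR] := Rmin [set x | x = a \/ x = b \/ x = c].
  + by exists a; left.
  + split; first by apply: mR; right; right.
    by move=> ac; apply: nab; apply: Ranti; rewrite // ac.
  + by case: nab; apply: Ranti => //; apply: mR; left.
  + by case: nbc; apply: Ranti => //; apply: mR; right; left.
- move=> a; apply: contrapT => na.
  have [m nm mR] := Rmin [set x | ~ Acc (fun a b => R a b /\ a <> b) x] (ex_intro _ a na).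
  apply: nm; constructor => y [ym nym]; apply: contrapT => ny.
  by apply: nym; apply: Ranti => //; exact: mR.
- move=> a b; have [->|/eqP ab] := eqVneq a b; first by constructor 2.
  by have [Rab|Rba] := Rtot a b; [constructor 1|constructor 3; split=> // /esym].
Qed.

(** Well-order the subsets of [nat] and cut at the least point with uncountably many predecessors,
    or take everything if there is no such point. *)
Lemma omega1_like_exists : exists (W : choiceType) (lt : W -> W -> Prop), omega1_like lt.
Proof.
have [lt [ltT ltW ltR]] := well_founded_lt_exists (set nat : choiceType).
suff [W0 W0u W0c] : exists2 W0 : set (set nat), ~ countable W0 &
    forall a, W0 a -> countable [set b | W0 b /\ lt b a].
  exists (set_type W0 : choiceType), (fun a b => lt (set_val a) (set_val b)).
  have valI : injective (set_val : set_type W0 -> set nat) by exact: val_inj.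
  split.
  - exact: small_injective valI small_set_nat.
  - by move=> a b c; exact: ltT.
  - move=> a; move: {2}(set_val a) (erefl (set_val a)) => x.
    elim: x / (ltW x) a => x _ IH a ax; constructor => b ba.
    by apply: (IH (set_val b)) => //; rewrite -ax.
  - move=> a b; case: (ltR (set_val a) (set_val b)); first by constructor 1.
      by move=> /valI; constructor 2.
    by constructor 3.
  - move=> a; apply: (countable_inj valI (W0c (set_val a) (set_valP a))).
    by move=> _ [b ba <-]; split=> //; exact: set_valP.
  - move=> cW; apply: W0u; apply: sub_countable cW.
    apply: (@card_le_trans _ _ _ (set_val @` [set: set_type W0])); last exact: card_image_le.
    by apply: subset_card_le => x W0x; exists (SigSub (mem_set W0x)).
case: (pselect (exists a, ~ countable [set b | lt b a])) => [[a]|na]; last first.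
  exists setT; first exact: uncountable_set_nat.
  move=> a _; rewrite (_ : [set b | _] = [set b | lt b a]).
    by apply: contrapT => ca; apply: na; exists a.
  by apply/seteqP; split=> b // [].
elim: a / (ltW a) => a _ IH ua.
case: (pselect (exists2 b, lt b a & ~ countable [set c | lt c b])) => [[b ba ub]|nb].
  exact: IH ba ub.
exists [set b | lt b a] => // b ba; apply: contrapT => ub; apply: nb; exists b => // cb.
by apply: ub; apply: sub_countable cb; apply: subset_card_le => c [].
Qed.

Section Omega1.
Context (W : choiceType) (lt : W -> W -> Prop) (oW : omega1_like lt).

Lemma lt_irrefl a : ~ lt a a.
Proof. by elim: a / (lt_wf oW a) => a _ IH aa; exact: (IH a aa aa). Qed.

Lemma lt_asym a b : lt a b -> ~ lt b a.
Proof. by move=> ab ba; exact: (lt_irrefl (lt_trans oW ab ba)). Qed.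

Lemma lt_min (P : set W) : P !=set0 -> exists2 m, P m & forall x, P x -> ~ lt x m.
Proof.
move=> [a Pa]; apply: contrapT => nP.
elim: a / (lt_wf oW a) Pa => a _ IH Pa.
by apply: nP; exists a => // x Px xa; exact: IH xa Px.
Qed.

Lemma countable_lt_bounded (B : set W) : countable B -> exists c, forall b, B b -> lt b c.
Proof.
move=> Bc; apply: contrapT => nB; apply: (lt_uncountable oW).
apply: (@sub_countable _ _ _ (\bigcup_(b in B) ([set x | lt x b] `|` [set b]))).
  apply: subset_card_le => c _; apply: contrapT => nc; apply: nB; exists c => b Bb.
  by case: (lt_total oW b c) => // [bc|cb]; case: nc; exists b => //; [right|left].
apply: bigcup_countable => // b Bb; rewrite -bigcup2E.
apply: bigcup_countable => // -[|[|i]] _ //=; exact: lt_initial oW b.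
Qed.

Lemma uncountable_unbounded (S : set W) c : ~ countable S -> exists2 s, S s & lt c s.
Proof.
move=> uS; apply: contrapT => nS; apply: uS.
have [d dP] := countable_lt_bounded (countable1 c).
apply: sub_countable (lt_initial oW d); apply: subset_card_le => s Ss /=.
have cd : lt c d by exact: dP.
case: (lt_total oW s c) => [sc|->//|cs]; first exact: lt_trans sc cd.
by case: nS; exists s.
Qed.

(** Elements carry distinct subsets [e s] of [nat]. If no membership bit cuts [S] into two
    uncountable parts, then every bit is constant on [S] outside a countable set, where at most one
    point can remain. *)
Lemma uncountable_split (S : set W) : ~ countable S ->
  exists S1 S2, [/\ S1 `<=` S, S2 `<=` S, S1 `&` S2 = set0,
    ~ countable S1 & ~ countable S2].
Proof.
move=> uS; have [e eI] := lt_small oW.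
have [[n [nS1 nS2]]|nS] := pselect (exists n,
    ~ countable (S `&` [set s | e s n]) /\ ~ countable (S `&` [set s | ~ e s n])).
  exists (S `&` [set s | e s n]), (S `&` [set s | ~ e s n]); split=> //; try by move=> s [].
  by apply/seteqP; split=> s // [[_ /= es] [_ /= nes]].
have /choice [f fP] : forall n, exists b : bool, countable (S `&` [set s | e s n <-> b]).
  move=> n; have [c1|nc1] := pselect (countable (S `&` [set s | e s n])).
    exists true; rewrite (_ : [set s | _ <-> _] = [set s | e s n]) //.
    by apply/seteqP; split=> s /=; [move=> [_]; apply|].
  exists false; rewrite (_ : [set s | _ <-> _] = [set s | ~ e s n]).
    by apply: contrapT => nc2; apply: nS; exists n.
  by apply/seteqP; split=> s /=; [move=> [+ _] es => /(_ es)|].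
pose B := \bigcup_n (S `&` [set s | e s n <-> f n]).
have Bc : countable B by apply: bigcup_countable => // n _; exact: fP.
case: uS; apply: contrapT => uS.
have [s [Ss nBs]] : (S `\` B) !=set0.
  apply: contrapT => SB; apply: uS; apply: sub_countable Bc.
  by apply: subset_card_le => s Ss; apply: contrapT => nBs; apply: SB; exists s.
apply: uS; apply: (@sub_countable _ _ _ (\bigcup_(b in [set: bool]) (if b then B else [set s]))).
  apply: subset_card_le => t St; have [Bt|nBt] := pselect (B t); first by exists true.
  exists false => //=; apply: eI.
  have eE r m : S r -> ~ B r -> e r m <-> ~~ f m.
    move=> Sr nBr; split=> [er|fm].
      by apply/negP => fm; apply: nBr; exists m.
    apply: contrapT => ner; apply: nBr; exists m => //; split=> //=.
    by split=> [/ner|]; rewrite ?(negbTE fm).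
  by apply/seteqP; split=> m; [move=> /(eE t m St nBt)/(eE s m Ss nBs)|
                               move=> /(eE s m Ss nBs)/(eE t m St nBt)].
by apply: bigcup_countable => // -[].
Qed.

Lemma omega1_recursion (Y : Type) (y0 : Y) (Sp : W -> (W -> Y) -> Y -> Prop) :
  (forall a f g y, (forall b, lt b a -> f b = g b) -> Sp a f y -> Sp a g y) ->
  (forall a f, (forall b, lt b a -> Sp b f (f b)) -> exists y, Sp a f y) ->
  exists f, forall a, Sp a f (f a).
Proof.
move=> Sext Sex.
have /choice [G GP] : forall af : W * (W -> Y), exists y,
    (exists y', Sp af.1 af.2 y') -> Sp af.1 af.2 y.
  move=> [a f]; case: (pselect (exists y, Sp a f y)) => [[y yP]|]; first by exists y.
  by exists y0.
(* Pads a function on the predecessors of [a] to a total one; locality of [Sp] makes the default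
   [y0] harmless. *)
pose ext a (h : forall b, lt b a -> Y) b :=
  if pselect (lt b a) is left ba then h b ba else y0.
pose F a h := G (a, @ext a h).
pose f := Fix (lt_wf oW) (fun=> Y) F.
have fE a : f a = G (a, ext a (fun b _ => f b)).
  rewrite /f Fix_eq // => x h g hg; congr (G (x, _)); apply: funext => b.
  by rewrite /ext; case: pselect.
have fext a b : lt b a -> f b = ext a (fun b _ => f b) b.
  by move=> ba; rewrite /ext; case: pselect.
exists f => a; elim: a / (lt_wf oW a) => a _ IH.
rewrite fE; apply: (Sext _ (ext a (fun b _ => f b))) => [b /fext //|].
apply: (GP (a, _)); have [y yP] := Sex a f IH; exists y.
exact: Sext (fext a) yP.
Qed.

End Omega1.

(** * A closed G_delta of density at most the continuum *)

Definition small_set (X : Type) (D : set X) := exists C : set nat -> X, D `<=` range C.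

Lemma small_set_bigcup (X I : Type) (P : set I) (D : I -> set X) : P !=set0 ->
  small I -> (forall i, P i -> small_set (D i)) -> small_set (\bigcup_(i in P) D i).
Proof.
move=> [i0 Pi0] sI DP.
have /choice [C CP] : forall i, exists C : set nat -> X, P i -> D i `<=` range C.
  move=> i; have [Pi|nPi] := pselect (P i); first by have [C] := DP i Pi; exists C.
  by have [C _] := DP i0 Pi0; exists C.
have [g gs] := small_surjective (small_prod sI small_set_nat) (i0, set0).
exists (fun c => C (g c).1 (g c).2) => x [i Pi /(CP i Pi)[c _ <-]].
by have [d dE] := gs (i, c); exists d; rewrite ?dE.
Qed.

Lemma small_setU1 (X : Type) (D : set X) z : small_set D -> small_set (z |` D).
Proof.
move=> [C DC]; rewrite (_ : z |` D = \bigcup_(b in [set: bool]) (if b then [set z] else D)).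
  apply: small_set_bigcup; [by exists true|exact: small_countType|].
  by case=> _; [exists (fun=> z) => _ ->; exists set0|exists C].
apply/seteqP; split=> x; first by case=> [->|Dx]; [exists true|exists false].
by case=> -[] _ /= Dx; [left|right].
Qed.

Section SmallDenseGdelta.
Context (X : topologicalType) (XX : compactum X) (n : nat) (A : 'I_n -> set X).
Context (Acover : \bigcup_i A i = [set: X]).
Context (Atight : forall i, countably_tight_subspace (A i)).

(** For the inductive step, choose along omega_1 decreasing closed G_deltas, each disjoint from the
    closure of the witness sets that the induction hypothesis supplies inside the earlier ones.
    Smallness of the witness sets keeps this recursion going. *)
Lemma reached_Gdelta :
  (forall G C, closed_Gdelta G -> G !=set0 -> ~ G `<=` closure (range (C : set nat -> X))) ->
  forall k F, closed_Gdelta F -> F !=set0 ->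
  exists z D, [/\ F z, D z, D `<=` F, small_set D & reached A k z D].
Proof.
move=> nosmall; elim=> [|k IH] F0 dF0 F0ne.
  have [z F0z] := F0ne; exists z, [set z]; split=> //; first by move=> _ ->.
    by exists (fun=> z) => _ ->; exists set0.
  exact: reached0.
have [W [lt oW]] := omega1_like_exists.
have /choice [psi psiP] : forall F, exists zD : X * set X,
    closed_Gdelta F -> F !=set0 ->
    [/\ F zD.1, zD.2 zD.1, zD.2 `<=` F, small_set zD.2 & reached A k zD.1 zD.2].
  move=> F; have [[dF Fne]|nF] := pselect (closed_Gdelta F /\ F !=set0).
    by have [z [D zDP]] := IH F dF Fne; exists (z, D).
  by have [z _] := F0ne; exists (z, set0) => dF Fne; case: nF.
pose before a f := \bigcup_(b in [set b | lt b a]) (psi (f b)).2.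
have [||f fP] := @omega1_recursion W lt oW (set X) setT (fun a f F =>
    [/\ closed_Gdelta F, F !=set0, F `<=` F0, forall b, lt b a -> F `<=` f b &
        F `&` closure (before a f) = set0]).
- move=> a f g F fg [dF Fne FF0 Ff Fcl]; split=> //.
    by move=> b ba; rewrite -fg //; exact: Ff.
  rewrite -[RHS]Fcl; congr (_ `&` closure _); apply: eq_bigcupr => b ba.
  by rewrite fg.
- move=> a f fP.
  pose K := F0 `&` \bigcap_(b in [set b | lt b a]) f b.
  have dK : closed_Gdelta K.
    apply: closed_GdeltaI => //; apply: closed_Gdelta_bigcap; first exact: lt_initial oW a.
    by move=> b /fP[].
  have Kne : K !=set0.
    (* [None] stands for [F0], which keeps the family inhabited at the first stage. *)
    pose H (o : option {b | lt b a}) := if o is Some b then f (sval b) else F0.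
    have Hsub (b : {b | lt b a}) : f (sval b) `<=` F0 by case: (fP _ (svalP b)).
    have [o|o|o p|x xH] := @directed_bigcap _ XX.1 _ H None.
    + by case: o => [b|] /=; [case: (fP _ (svalP b)) => -[]|case: dF0].
    + by case: o => [b|] //=; case: (fP _ (svalP b)).
    + case: o p => [b|] [c|].
      * case: (lt_total oW (sval b) (sval c)) => [bc|bc|cb].
        - exists (Some c) => x xc; split=> //=.
          by case: (fP _ (svalP c)) => _ _ _ /(_ _ bc x xc).
        - by exists (Some b) => x xb; split=> //=; rewrite -bc.
        - exists (Some b) => x xb; split=> //=.
          by case: (fP _ (svalP b)) => _ _ _ /(_ _ cb x xb).
      * by exists (Some b) => x xb; split=> //; exact: Hsub xb.
      * by exists (Some c) => x xc; split=> //; exact: Hsub xc.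
      * by exists None.
    exists x; split; first exact: (xH None).
    by move=> b ba; exact: (xH (Some (exist _ b ba))).
  have [C CP] : small_set (before a f).
    have [[b ba]|na] := pselect (exists b, lt b a).
      apply: small_set_bigcup; [by exists b|exact: lt_small oW|].
      by move=> c /fP[dfc fcne _ _ _]; case: (psiP _ dfc fcne).
    by have [z _] := F0ne; exists (fun=> z) => x [b ba]; case: na; exists b.
  have [x [Kx nCx]] : (K `\` closure (range C)) !=set0.
    apply: contrapT => KC; apply: (nosmall K C dK Kne) => x Kx.
    by apply: contrapT => nCx; apply: KC; exists x.
  have [G [dG Gx GC]] := closed_Gdelta_nbhs XX (closed_openC (@closed_closure _ (range C))) nCx.
  exists (K `&` G); split.
  + exact: closed_GdeltaI.
  + by exists x.
  + by move=> y [[]].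
  + by move=> b ba y [[_ /(_ b ba)]].
  + by apply/seteqP; split=> // y [[_ /GC nCy] /(closureS CP)].
pose z a := (psi (f a)).1; pose D a := (psi (f a)).2.
have zDP a : [/\ f a (z a), D a (z a), D a `<=` f a, small_set (D a) & reached A k (z a) (D a)].
  by case: (fP a) => dfa fane _ _ _; exact: psiP.
have [w0 _] : [set: W] !=set0.
  by apply/set0P/eqP => W0; apply: (lt_uncountable oW); rewrite W0; exact: countable0.
have [a|a b|a|B y BD Bc yf By|y yf yr] := @reached_step X n A XX.1 Acover Atight k W f
    (\bigcup_a D a) w0.
- by case: (fP a) => -[].
- case: (lt_total oW a b) => [ab|<-|ba].
  + by exists b => x xb; split=> //; case: (fP b) => _ _ _ /(_ _ ab x xb).
  + by exists a.
  + by exists a => x xa; split=> //; case: (fP a) => _ _ _ /(_ _ ba x xa).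
- exists (z a); case: (zDP a) => fz Dz _ _ rz; split=> //; first by exists a.
  by apply: reachedS rz => x Dx; exists a.
- have /choice [g gP] : forall x, exists a, B x -> D a x.
    move=> x; have [Bx|nBx] := pselect (B x); last by exists w0.
    by have [a _ Dax] := BD x Bx; exists a.
  (* A countable [B] uses only witness sets of stages before some [c], and [f c] misses their
     closure. *)
  have [c cP] := countable_lt_bounded oW (sub_countable (card_image_le g B) Bc).
  case: (fP c) => _ _ _ _ fc; have : set0 y; last by [].
  rewrite -fc; split; first exact: yf.
  by apply: closureS By => x Bx; exists (g x); [apply: cP; exists x|exact: gP].
- exists y, (y |` \bigcup_a D a); split.
  + by case: (fP w0) => _ _ /(_ y (yf w0)).
  + by left.
  + move=> x [->|[a _ Dx]]; first by case: (fP w0) => _ _ /(_ y (yf w0)).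
    by case: (fP a) => _ _ fF0 _ _; apply: fF0; case: (zDP a) => _ _ /(_ x Dx).
  + apply: small_setU1; apply: small_set_bigcup; [by exists w0|exact: lt_small oW|].
    by move=> a _; case: (zDP a).
  + by apply: reachedS yr; exact: subsetUr.
Qed.

Lemma small_dense_Gdelta : [set: X] !=set0 ->
  exists G (C : set nat -> X), [/\ closed_Gdelta G, G !=set0 & G `<=` closure (range C)].
Proof.
move=> Xne; apply: contrapT => nG.
have [||z [D [_ _ _ _]]] := @reached_Gdelta _ n.+1 setT _ Xne.
- by move=> G C dG Gne GC; apply: nG; exists G, C.
- exact: closed_GdeltaT.
- exact: reached_unbounded.
Qed.

End SmallDenseGdelta.

(** * Independent pairs of closed sets *)

Lemma countable_seq_over (T : choiceType) (E : set T) : countable E ->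
  countable [set s : seq T | forall e, e \in s -> E e].
Proof.
move=> /countable_injP[f fI]; apply/countable_injP.
exists (fun s => pickle (map f s)) => s t; rewrite !inE => sE tE /(pcan_inj (@pickleK _)).
elim: s t sE tE => [|a s IH] [|b t] //= sE tE [/fI ab st]; congr cons.
  by apply: ab; rewrite inE; [apply: sE|apply: tE]; exact: mem_head.
by apply: IH st => e es; [apply: sE|apply: tE]; rewrite inE es orbT.
Qed.

(** * Pressing down on an order of type omega_1 *)

Section PressingDown.
Context (W : choiceType) (lt : W -> W -> Prop) (oW : omega1_like lt).

Definition below (a : W) (s : seq (W * bool)) := forall e, e \in s -> lt e.1 a.

Lemma countable_below a : countable (below a).
Proof.
apply: (@countable_seq_over _ [set e | lt e.1 a]).
apply: sub_countable (countableX (lt_initial oW a) (countableP [set: bool])).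
by apply: subset_card_le => -[b c].
Qed.

Lemma omega1_inhabited : exists a : W, True.
Proof.
apply: contrapT => nW; apply: (lt_uncountable oW).
by rewrite (_ : [set: W] = set0) //; apply/seteqP; split=> // a _; apply: nW; exists a.
Qed.

(** If every fibre were countable, each would have a bound [bd s]. At a suitable [delta], closed
    under these bounds, [bd (sig delta)] would lie both above and below [delta]. *)
Lemma pressing_down (sig : W -> seq (W * bool)) :
  (forall a, below a (sig a)) -> exists s, ~ countable [set a | sig a = s].
Proof.
move=> sigP; apply: contrapT => /forallNP nS.
have /choice [bd bdP] : forall s, exists c, forall a, sig a = s -> lt a c.
  move=> s; apply: (@countable_lt_bounded _ _ oW [set a | sig a = s]).
  by apply: contrapT; exact: nS.
have /choice [g gP] : forall d, exists c, lt d c /\ forall s, below d s -> lt (bd s) c.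
  move=> d; have [|c cP] := @countable_lt_bounded _ _ oW ([set d] `|` bd @` below d).
    rewrite -bigcup2E; apply: bigcup_countable => // -[|[|i]] _ //=.
    exact: sub_countable (card_image_le _ _) (countable_below d).
  by exists c; split=> [|s sd]; apply: cP; [left|right; exists s].
(* [delta] is a closure point of [g], so the finite set [sig delta] is bounded
   strictly below it, at a stage where [bd (sig delta)] is already exceeded. *)
have [w _] := omega1_inhabited; pose d m := iter m g w.
have [|delta dd dmin] := @lt_min _ _ oW [set c | forall m, lt (d m) c].
  have [|c cP] := @countable_lt_bounded _ _ oW (range d).
    exact: sub_countable (card_image_le _ _) (countableP _).
  by exists c => m; apply: cP; exists m.
have dS m k a : lt a (d m) -> lt a (d (m + k)).
  elim: k => [|k IH] am; rewrite ?addn0 // addnS.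
  by apply: (lt_trans oW (IH am)); case: (gP (d (m + k))).
have [M sM] : exists M, below (d M) (sig delta).
  have : below delta (sig delta) by [].
  elim: (sig delta) => [|e s IH] sd; first by exists 0 => e.
  have [M MP] := IH (fun c cs => sd c (mem_behead (s := e :: s) cs)).
  have [m em] : exists m, ~ lt (d m) e.1.
    by apply/existsNP => /dmin; apply; apply: sd; exact: mem_head.
  exists (m.+1 + M) => c; rewrite inE => /orP[/eqP->|/MP cM]; last by rewrite addnC; exact: dS.
  apply: dS; have [dg _] := gP (d m).
  by case: (lt_total oW e.1 (d m)) => [el|->//|//]; exact: (lt_trans oW el dg).
apply: (lt_asym oW (bdP _ delta erefl)).
by apply: (lt_trans oW _ (dd M.+1)); case: (gP (d M)) => _; apply.
Qed.

End PressingDown.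

(** * Local pi-bases and Shapirovskii's construction *)

Section PiCharacter.
Context (X : topologicalType) (XX : compactum X).

Definition countable_pi_base (p : X) := exists B : nat -> set X,
  (forall n, open (B n) /\ B n !=set0) /\
  forall O, nbhs p O -> exists n, B n `<=` O.

(** With [closure (V n)] inside [U n], the closures of the finite intersections of the [V n]
    decrease and meet in [F]; compactness puts one of them inside [O]. *)
Lemma closed_Gdelta_outer_base (F : set X) : closed_Gdelta F -> exists B : nat -> set X,
  (forall n, open (B n) /\ F `<=` B n) /\
  forall O, open O -> F `<=` O -> exists n, B n `<=` O.
Proof.
move=> [Fcl [U [Uo FU]]].
have /choice [V VP] : forall n, exists V, [/\ open V, F `<=` V & closure V `<=` U n].
  by move=> n; apply: compactum_shrink => //; rewrite FU => x /(_ n I).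
pose B := fix B n := if n is m.+1 then B m `&` V m else setT.
exists B; split.
  elim=> [|n [Bo FB]]; first by split=> //; exact: openT.
  by case: (VP n) => Vo FV _; split; [exact: openI|move=> x Fx; split; [exact: FB|exact: FV]].
move=> O Oo FO; apply: contrapT => /forallNP nB.
have Bdecr m k : B (m + k) `<=` B m.
  by elim: k => [|k IH]; rewrite ?addn0 // addnS => x [/IH].
have [n|n|m n|x xP] := @directed_bigcap _ XX.1 _ (fun n => closure (B n) `&` ~` O) 0.
- by apply: closedI; [exact: closed_closure|exact: open_closedC].
- apply: contrapT => nO; apply: (nB n) => x Bx; apply: contrapT => nOx; apply: nO.
  by exists x; split=> //; exact: subset_closure.
- exists (m + n) => x [Bx nOx].
  by split; split=> //; apply: closureS Bx; [|rewrite addnC]; exact: Bdecr.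
- case: (xP 0) => _; apply; apply: FO; rewrite FU => n _.
  case: (VP n) => _ _; apply; case: (xP n.+1) => + _.
  by apply: closureS => y [].
Qed.

(** Otherwise every open set around [p] contains one of the countably many [F t], and their
    countable outer bases together form a local pi-base at [p]. *)
Lemma no_pi_base_avoid (T : Type) (C : set T) (F : T -> set X) (p : X) :
  countable C -> (forall t, C t -> closed_Gdelta (F t) /\ F t !=set0) ->
  ~ countable_pi_base p -> exists O, [/\ open O, O p & forall t, C t -> ~ F t `<=` O].
Proof.
move=> Cc CF np; apply: contrapT => nO; apply: np.
have FO O : open O -> O p -> exists2 t, C t & F t `<=` O.
  move=> Oo Op; apply: contrapT => nF; apply: nO; exists O; split=> // t Ct Ft.
  by apply: nF; exists t.
have [t0 Ct0 _] := FO setT openT I.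
have [u uC] := countable_range Cc (ex_intro _ t0 Ct0).
have /choice [B BP] : forall i, exists B : nat -> set X,
    (forall n, open (B n) /\ F (u i) `<=` B n) /\
    forall O, open O -> F (u i) `<=` O -> exists n, B n `<=` O.
  by move=> i; apply: closed_Gdelta_outer_base; case: (CF (u i)); rewrite // uC; exists i.
exists (fun k => if unpickle k is Some q then B q.1 q.2 else setT); split.
  move=> k; case: unpickle => [[i m] /=|]; last by split; [exact: openT|exists p].
  case: (BP i) => /(_ m)[Bo FB] _; split=> //.
  have [|x Fx] := (CF (u i) _).2; first by rewrite uC; exists i.
  by exists x; exact: FB.
move=> O; rewrite nbhsE => -[V [Vo Vp] VO].
have [t] := FO V Vo Vp; rewrite uC => -[i _ <-] FV.
case: (BP i) => _ /(_ V Vo FV)[m mV]; exists (pickle (i, m)); rewrite pickleK /=.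
exact: subset_trans VO.
Qed.

Definition meets (E : choiceType) (F : E -> set X) (s : seq E) : set X :=
  [set x | forall e, e \in s -> F e x].

Lemma meets_catl (E : choiceType) (F : E -> set X) s t : meets F (s ++ t) `<=` meets F s.
Proof. by move=> x xP e es; apply: xP; rewrite mem_cat es. Qed.

(* Shapirovskii's splitting step: otherwise shrinking away successively from a
   finite cover by small neighbourhoods would leave a nonempty set. *)
Lemma splitting_pair (E : choiceType) (C : set E) (F : E -> set X) : [set: X] !=set0 ->
  (forall p, ~ countable_pi_base p) -> countable C ->
  (forall e, C e -> closed_Gdelta (F e)) ->
  exists P Q s, [/\ closed_Gdelta P, closed_Gdelta Q, P `&` Q = set0 &
    [/\ forall e, e \in s -> C e, meets F s !=set0 &
      forall t, (forall e, e \in t -> C e) -> meets F (s ++ t) !=set0 ->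
        meets F (s ++ t) `&` P !=set0 /\ meets F (s ++ t) `&` Q !=set0]].
Proof.
move=> [x0 _] nopi Cc CF.
have dF s : (forall e, e \in s -> C e) -> closed_Gdelta (meets F s).
  move=> sC; apply: (@closed_Gdelta_bigcap X E [set` s] F) => [|e /sC /CF //].
  exact: finite_set_countable.
pose S := [set s | (forall e, e \in s -> C e) /\ meets F s !=set0].
have Sc : countable S.
  by apply: sub_countable (countable_seq_over Cc); apply: subset_card_le => s [].
have /choice [PQ PQP] : forall p : X, exists PQ : set X * set X,
    [/\ closed_Gdelta PQ.1, closed_Gdelta PQ.2, PQ.1 `&` PQ.2 = set0, nbhs p PQ.1 &
      forall s, S s -> meets F s `&` PQ.2 !=set0].
  move=> p; have [|O [Oo Op OS]] := @no_pi_base_avoid _ S (meets F) p Sc _ (nopi p).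
    by move=> s [sC sne]; split=> //; exact: dF.
  have [P [Q [dP dQ PQ0 pP OQ]]] := closed_Gdelta_pair XX Oo Op.
  exists (P, Q); split=> // s /OS sO; apply: contrapT => sQ; apply: sO => x sx.
  by apply: contrapT => nOx; apply: sQ; exists x; split=> //; exact: OQ.
have [|ps psP] := @compact_finite_cover _ XX.1 (fun p => (PQ p).1).
  by move=> p; case: (PQP p).
have [p [s [[sC sne] sP]]] : exists p s, S s /\
    forall t, S (s ++ t) -> meets F (s ++ t) `&` (PQ p).1 !=set0.
  apply: contrapT => np.
  have [s [_ [x sx]] sps] : exists2 s, S s & forall p, p \in ps -> meets F s `&` (PQ p).1 = set0.
    elim: ps {psP} => [|p ps [s Ss sps]]; first by exists [::] => //; split=> //; exists x0.
    have [t St tp] : exists2 t, S (s ++ t) & meets F (s ++ t) `&` (PQ p).1 = set0.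
      apply: contrapT => nt; apply: np; exists p, s; split=> // t St.
      by apply/set0P/eqP => tp; apply: nt; exists t.
    exists (s ++ t) => // q; rewrite inE => /orP[/eqP->//|qps].
    by rewrite -subset0 -(sps q qps); apply: setSI; exact: meets_catl.
  by have [p pps Px] := psP x; have : set0 x; last by []; rewrite -(sps p pps).
have [dP dQ PQ0 _ SQ] := PQP p.
exists (PQ p).1, (PQ p).2, s; split=> //; split=> // t tC stne.
have Sst : S (s ++ t) by split=> // e; rewrite mem_cat => /orP[/sC|/tC].
by split; [exact: sP|exact: SQ].
Qed.

(** Stage [a] receives a finite condition on earlier sides and a pair whose two members both meet
    every nonempty finite intersection extending that condition. Pressing down makes the condition
    constant on an uncountable [S], where the pairs are then independent. *)
Lemma independent_pairs : [set: X] !=set0 -> (forall p : X, ~ countable_pi_base p) ->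
  exists (W : choiceType) (lt : W -> W -> Prop) (oW : omega1_like lt)
    (S : set W) (P Q : W -> set X),
  [/\ ~ countable S, forall a, closed (P a), forall a, closed (Q a),
    forall a, P a `&` Q a = set0 &
    forall s : W -> bool, exists x, forall a, S a -> (if s a then P a else Q a) x].
Proof.
move=> Xne nopi; have [W [lt oW]] := omega1_like_exists.
pose Y := (set X * set X * seq (W * bool))%type.
pose side (f : W -> Y) (e : W * bool) := if e.2 then (f e.1).1.1 else (f e.1).1.2.
have [||f fP] := @omega1_recursion W lt oW Y (set0, set0, [::]) (fun a f y =>
   [/\ closed_Gdelta y.1.1, closed_Gdelta y.1.2, y.1.1 `&` y.1.2 = set0 &
    [/\ below lt a y.2, meets (side f) y.2 !=set0 &
      forall t, below lt a t -> meets (side f) (y.2 ++ t) !=set0 ->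
        meets (side f) (y.2 ++ t) `&` y.1.1 !=set0 /\
        meets (side f) (y.2 ++ t) `&` y.1.2 !=set0]]).
- move=> a f g [[P Q] s] fg /= [dP dQ PQ0 [sa sne sP]].
  have fgE t : below lt a t -> meets (side f) t = meets (side g) t.
    move=> ta; apply/seteqP; split=> x xt e et; have := xt e et;
      by rewrite /side (fg _ (ta e et)).
  split=> //; split; rewrite -?fgE // => t ta; rewrite -fgE; first exact: sP.
  by move=> e; rewrite mem_cat => /orP[/sa|/ta].
- move=> a f fP.
  have [|e ea|P [Q [s [dP dQ PQ0 [sa sne sP]]]]] :=
    @splitting_pair _ [set e | lt e.1 a] (side f) Xne nopi.
  + apply: sub_countable (countableX (lt_initial oW a) (countableP [set: bool])).
    by apply: subset_card_le => -[b c].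
  + by rewrite /side; case: (fP _ ea) => dP dQ _ _; case: ifP.
  by exists (P, Q, s).
have [|s0 Sunc] := @pressing_down W lt oW (fun a => (f a).2).
  by move=> a; case: (fP a) => _ _ _ [].
pose S := [set a | (f a).2 = s0].
exists W, lt, oW, S, (fun a => (f a).1.1), (fun a => (f a).1.2); split=> //.
- by move=> a; case: (fP a) => -[].
- by move=> a; case: (fP a) => _ [].
- by move=> a; case: (fP a).
move=> s.
(* Induction on a bound of [l]: the greatest index comes last, its pair splitting what the smaller
   ones leave. *)
have indep a l : (forall b, b \in l -> S b /\ lt b a) ->
    meets (side f) (s0 ++ [seq (b, s b) | b <- l]) !=set0.
  elim: a / (lt_wf oW a) l => a _ IH l lP.
  have [[m [ml mmax]]|l0] : (exists m, m \in l /\ forall b, b \in l -> b = m \/ lt b m) \/ l = [::].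
    elim: l {lP} => [|b l [[m [ml mmax]]|->]]; first by right.
      left; case: (lt_total oW b m) => bm.
      + exists m; rewrite inE ml orbT; split=> // c; rewrite inE => /orP[/eqP->|/mmax //].
        by right.
      + exists m; rewrite inE ml orbT; split=> // c; rewrite inE => /orP[/eqP->|/mmax //].
        by left.
      + exists b; rewrite mem_head; split=> // c; rewrite inE => /orP[/eqP->|/mmax]; first by left.
        by case=> [->|cm]; right=> //; exact: (lt_trans oW cm bm).
    by left; exists b; rewrite mem_head; split=> // c; rewrite mem_seq1 => /eqP; left.
  - have [Sm ma] := lP m ml.
    pose l' := [seq b <- l | b != m].
    have l'P b : b \in l' -> S b /\ lt b m.
      rewrite mem_filter => /andP[/eqP bm bl]; split; first by case: (lP b bl).
      by case: (mmax b bl).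
    have := IH m ma l' l'P; case: (fP m) => _ _ _ [_ _ +] ne.
    rewrite Sm => /(_ [seq (b, s b) | b <- l']) [|//|[x [xl' Px]] [y [yl' Qy]]].
      by move=> _ /mapP[b /l'P[_ bm] ->].
    have [z [zl' sz]] : exists z,
        meets (side f) (s0 ++ [seq (b, s b) | b <- l']) z /\ side f (m, s m) z.
      by rewrite /side /=; case: (s m); [exists x|exists y].
    exists z => e; rewrite mem_cat => /orP[es0|/mapP[b bl ->]].
      by apply: zl'; rewrite mem_cat es0.
    have [->//|bm] := eqVneq b m.
    by apply: zl'; rewrite mem_cat; apply/orP; right; apply: map_f; rewrite mem_filter bm.
  - rewrite l0 cats0; have [c Sc] : S !=set0.
      by apply/set0P/eqP => S0; apply: Sunc; rewrite -/S S0.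
    by case: (fP c) => _ _ _ [_]; rewrite Sc.
have [l|l|l k|x xP] := @directed_bigcap X XX.1 (seq W)
    (fun l => \bigcap_(b in [set b | b \in l /\ S b]) side f (b, s b)) [::].
- apply: closed_bigI => b _; rewrite /side /=.
  by case: (fP b) => -[Pcl _] [Qcl _] _ _; case: (s b).
- have [a aP] := countable_lt_bounded oW (finite_set_countable (finite_seq l)).
  have [|x xP] := indep a [seq b <- l | `[< S b >]].
    by move=> b; rewrite mem_filter => /andP[/asboolP Sb bl]; split=> //; exact: aP.
  exists x => b [bl Sb]; apply: xP; rewrite mem_cat; apply/orP; right.
  by apply: map_f; rewrite mem_filter bl andbT; apply/asboolP.
- exists (l ++ k) => x xlk.
  by split=> b [bl Sb]; apply: xlk; split=> //; rewrite mem_cat bl ?orbT.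
by exists x => a Sa; apply: (xP [:: a] a); split=> //; exact: mem_head.
Qed.

End PiCharacter.

(** * A point with a countable local pi-base *)

Section CountablePiBase.
Context (X : topologicalType) (XX : compactum X) (n : nat) (A : 'I_n -> set X).
Context (Acover : \bigcup_i A i = [set: X]).
Context (Atight : forall i, countably_tight_subspace (A i)).
Context (W : choiceType) (lt : W -> W -> Prop) (oW : omega1_like lt).
Context (P Q : W -> set X) (Pcl : forall a, closed (P a)) (Qcl : forall a, closed (Q a)).
Context (PQ0 : forall a, P a `&` Q a = set0).

(* Half of the pairs cut [E] into a free sequence of slices; the other half stays
   independent on every slice. *)
Lemma reached_independent k S E : ~ countable S -> closed E ->
  (forall s : W -> bool, exists2 x, E x &
    forall a, S a -> (if s a then P a else Q a) x) ->
  exists2 z, E z & reached A k z E.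
Proof.
elim: k S E => [|k IH] S E uS Ecl indep.
  by have [z Ez _] := indep (fun=> true); exists z => //; exact: reached0.
have [S1 [S2 [S1S S2S S120 uS1 uS2]]] := uncountable_split oW uS.
(* The pairs of [S1] switch from [P] to [Q] after stage [a], as in a free sequence. *)
pose slice a := E `&` [set x | forall c, S1 c -> (if `[< lt a c >] then Q c else P c) x].
have slice_cl a : closed (slice a).
  apply: closedI => //; rewrite (_ : [set x | _] =
    \bigcap_(c in S1) (if `[< lt a c >] then Q c else P c)) //.
  by apply: closed_bigI => c _; case: ifP.
have slice_reached a : exists2 z, slice a z & reached A k z (slice a).
  apply: (IH S2) => // s.
  (* On [S1] the pattern realizes the slice, elsewhere it follows the prescribed [s]. *)
  have [x Ex xP] := indep (fun c => if `[< S1 c >] then ~~ `[< lt a c >] else s c).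
  exists x; first split=> // c S1c.
    by have := xP c (S1S c S1c); rewrite asboolT // if_neg.
  move=> c S2c; have := xP c (S2S c S2c); rewrite asboolF // => S1c.
  by have : set0 c by rewrite -S120.
have [s0 S1s0] : S1 !=set0.
  by apply/set0P/eqP => S10; apply: uS1; rewrite S10; exact: countable0.
(* Keeping only the constraints up to [a] makes [H] decreasing while it still contains the slice. *)
pose H a := E `&` \bigcap_(c in [set c | S1 c /\ ~ lt a c]) P c.
have sliceH a : slice a `<=` H a.
  move=> x [Ex xP]; split=> // c [S1c nac].
  by have := xP c S1c; rewrite asboolF.
have Hmono a b : lt a b -> H b `<=` H a.
  move=> ab x [Ex xP]; split=> // c [S1c nac]; apply: xP; split=> // bc.
  exact/nac/(lt_trans oW ab bc).
have [a|a b|a|B z BD Bc zH Bz|z zH rz] := @reached_step X n A XX.1 Acover Atight k W H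
    (\bigcup_a slice a) s0.
- by apply: closedI => //; apply: closed_bigI.
- case: (lt_total oW a b) => [ab|<-|ba].
  + by exists b => x xb; split=> //; exact: Hmono xb.
  + by exists a.
  + by exists a => x xa; split=> //; exact: Hmono xa.
- have [z za rz] := slice_reached a; exists z; split; first exact: sliceH.
    by exists a.
  by apply: reachedS rz => x xa; exists a.
- have /choice [g gP] : forall x, exists a, B x -> slice a x.
    move=> x; have [Bx|nBx] := pselect (B x); last by exists s0.
    by have [a _ ax] := BD x Bx; exists a.
  have [c cP] := countable_lt_bounded oW (sub_countable (card_image_le g B) Bc).
  (* For [d] in [S1] beyond all slices chosen for points of [B], the closed set [Q d] contains [B],
     while [z] lies in [P d]. *)
  have [d S1d cd] := @uncountable_unbounded _ _ oW S1 c uS1.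
  have : set0 z; last by [].
  rewrite -(PQ0 d); split.
    by case: (zH d) => _; apply; split=> //; exact: lt_irrefl oW d.
  apply: Qcl; apply: closureS Bz => x Bx.
  have [_ /(_ d S1d)] := gP x Bx; rewrite asboolT //.
  by apply: (lt_trans oW _ cd); apply: cP; exists x.
- exists z; first by case: (zH s0).
  by apply: reachedS rz => x [a _ []].
Qed.

End CountablePiBase.

Lemma exists_countable_pi_base (X : topologicalType) (n : nat) (A : 'I_n -> set X) :
  compactum X -> \bigcup_i A i = [set: X] ->
  (forall i, countably_tight_subspace (A i)) -> [set: X] !=set0 ->
  exists p : X, countable_pi_base p.
Proof.
move=> XX Acover Atight Xne; apply: contrapT => /forallNP nopi.
have [W [lt [oW [S [P [Q [uS Pcl Qcl PQ0 indep]]]]]]] := independent_pairs XX Xne nopi.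
have [|z _] := reached_independent XX Acover Atight oW Pcl Qcl PQ0 n.+1 uS closedT.
  by move=> s; have [x xP] := indep s; exists x.
exact: reached_unbounded.
Qed.

(** * A dense set of size at most the continuum *)

Section SmallDense.
Context (X : topologicalType) (XX : compactum X) (n : nat) (A : 'I_n -> set X).
Context (Acover : \bigcup_i A i = [set: X]).
Context (Atight : forall i, countably_tight_subspace (A i)).
Context (U : X -> nat -> set X) (C : X -> set nat -> X).
Context (Uopen : forall x m, open (U x m)) (Ux : forall x m, U x m x).
Context (UC : forall x, \bigcap_m U x m `<=` closure (range (C x))).

(* Points of [closure (range u)] with the same traces on [u] of suitably shrunken
   [U x m] lie in each other's [\bigcap_m U x m]. *)
Lemma separable_small_cover : exists T : (nat -> X) -> set nat -> X,
  forall u x, closure (range u) x -> exists c, (\bigcap_m U (T u c) m) x.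
Proof.
have /choice [V VP] : forall x, exists V : nat -> set X,
    forall m, [/\ open (V m), V m x & closure (V m) `<=` U x m].
  move=> x; suff /choice [V VP] : forall m, exists V, [/\ open V, V x & closure V `<=` U x m].
    by exists V.
  move=> m; have [|V [Vo xV VU]] := compactum_shrink XX (compactum_closed1 XX (x:=x)) (Uopen x m).
    by move=> _ ->.
  by exists V; split=> //; exact: xV.
pose e (u : nat -> X) x (m : nat) := [set i | V x m (u i)].
have [g gs] := small_surjective (small_fun nat small_set_nat) (fun=> set0).
have /choice [T TP] : forall uc : (nat -> X) * set nat, exists y,
    (exists2 x, closure (range uc.1) x & e uc.1 x = g uc.2) ->
    closure (range uc.1) y /\ e uc.1 y = g uc.2.
  move=> [u c] /=; case: (pselect (exists2 x, closure (range u) x & e u x = g c)).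
    by move=> [x ux xc]; exists x.
  by move=> nx; exists (u 0) => /nx.
exists (fun u c => T (u, c)) => u x ux; have [c cE] := gs (e u x).
exists c => m _; have [|_ /= Te] := TP (u, c); first by exists x.
have VeT i : V x m (u i) -> V (T (u, c)) m (u i).
  have : e u (T (u, c)) m = e u x m by rewrite Te cE.
  by move=> E Vi; have : e u x m i by []; rewrite -E.
case: (VP (T (u, c)) m) => _ _; apply => O xO.
have [Vo Vx _] := VP x m.
have [_ [[i _ <-] [Oi Vi]]] := ux _ (filterI xO (open_nbhs_nbhs (conj Vo Vx))).
by exists (u i); split=> //; exact: VeT.
Qed.

Context (T : (nat -> X) -> set nat -> X).
Context (TP : forall u x, closure (range u) x -> exists c, (\bigcap_m U (T u c) m) x).

(** Closure under [T] covers the closure of each countable part of [N] by small G_deltas attached to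
    points of [N]; closure under [C] puts these G_deltas inside the closure of [N]. *)
Definition saturated (N : set X) :=
  (forall u c, range u `<=` N -> N (T u c)) /\ (forall x c, N x -> N (C x c)).

(** A fragment of elementarity: an outside point [q] is reflected into [N] with respect to finitely
    many neighbourhoods at a time. *)
Definition escapes k (N : set X) := forall (nu : X -> nat) q,
  (forall y, N y -> ~ U y (nu y) q) ->
  forall s : seq X, (forall y, y \in s -> N y) ->
  exists z, [/\ N z, forall y, y \in s -> ~ U y (nu y) z & reached A k z N].

(** [reached_step] is applied to the complements of finite unions of chosen neighbourhoods. A limit
    of a countable part [range u] of [N] cannot avoid all neighbourhoods, since for some [c] it lies
    in every [U (T u c) m]. *)
Lemma escapes_reached k N (nu : X -> nat) q : N !=set0 -> saturated N -> escapes k N ->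
  (forall y, N y -> ~ U y (nu y) q) ->
  exists2 z, (forall y, N y -> ~ U y (nu y) z) & reached A k.+1 z N.
Proof.
move=> [x0 Nx0] [satT _] esc qP.
have [s|s t|s|B z BN Bc zH Bz|z zH rz] := @reached_step X n A XX.1 Acover Atight k (seq X)
    (fun s => \bigcap_(y in [set y | y \in s /\ N y]) ~` U y (nu y)) N [::].
- by apply: closed_bigI => y _; exact: open_closedC.
- exists (s ++ t) => x xP.
  by split=> y [ys Ny]; apply: xP; split=> //; rewrite mem_cat ys ?orbT.
- have [|z [Nz zs rz]] := esc nu q qP [seq y <- s | `[< N y >]].
    by move=> y; rewrite mem_filter => /andP[/asboolP].
  exists z; split=> // y [ys Ny]; apply: zs.
  by rewrite mem_filter ys andbT; apply/asboolP.
- have [|u uB] := countable_range Bc.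
    by have [b [Bb _]] := Bz _ filterT; exists b.
  move: Bz BN; rewrite uB => /TP[c Tc] uN; have NT := satT u c uN.
  have := zH [:: T u c] (T u c); apply; last exact: Tc.
  by split=> //; exact: mem_head.
- exists z => // y Ny; have := zH [:: y] y; apply; split=> //; exact: mem_head.
Qed.

(* The next hull is a countably directed union of hulls of the previous level, so
   the points supplied by [escapes_reached] can be picked inside it. *)
Lemma escaping_hull k : X -> exists Phi : (nat -> X) -> set nat -> X, forall u,
  [/\ range u `<=` range (Phi u), saturated (range (Phi u)) & escapes k (range (Phi u))].
Proof.
move=> x0; elim: k => [|k [Phi PhiP]].
  have /choice [z zP] : forall lv : seq (nat * nat) * (nat -> X), exists z,
      (exists q, forall p, p \in lv.1 -> ~ U (lv.2 p.1) p.2 q) ->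
      forall p, p \in lv.1 -> ~ U (lv.2 p.1) p.2 z.
    move=> [l v] /=; case: (pselect (exists q, forall p, p \in l -> ~ U (v p.1) p.2 q)).
      by move=> [q qP]; exists q.
    by move=> nq; exists x0 => /nq.
  have [|Phi PhiP] := @small_hull X (set nat + set nat + seq (nat * nat)) (fun i v =>
      match i with
      | inl (inl c) => T v c
      | inl (inr c) => C (v 0) c
      | inr l => z (l, v)
      end).
    apply: small_sum; last exact: small_countType.
    exact: small_sum small_set_nat small_set_nat.
  exists Phi => u; have [uN NF] := PhiP u; split=> //.
    split=> [v c vN|x c Nx]; first exact: (NF (inl (inl c)) v vN).
    by apply: (NF (inl (inr c)) (fun=> x)) => _ [_ _ <-].
  (* The list becomes a sequence padded with [u 0], to fit operations of countable arity. *)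
  move=> nu q qN s sN; pose v i := nth (u 0) s i.
  have vN : range v `<=` range (Phi u).
    move=> _ [i _ <-]; have [si|si] := ltnP i (size s); first exact/sN/mem_nth.
    by rewrite /v nth_default //; apply: uN; exists 0.
  pose l := mkseq (fun i => (i, nu (v i))) (size s).
  have := zP (l, v); set y0 := z (l, v) => /= y0P.
  exists y0; split; [exact: (NF (inr l) v vN)| |exact: reached0].
  have {}y0P : forall p, p \in l -> ~ U (v p.1) p.2 y0.
    apply: y0P; exists q => p /mapP[i _ ->] /=; apply: qN.
    by apply: vN; exists i.
  move=> y ys; have := y0P (index y s, nu (v (index y s))).
  rewrite /v /= nth_index //; apply.
  by apply/mapP; exists (index y s); rewrite ?mem_iota ?index_mem // /v nth_index.
(* Points of the hull of [v] are named by codes in [set nat], so the requests [(l, J)] form a small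
   index type. *)
pose good (l : seq (set nat * nat)) (J : {set 'I_n}) v w :=
  (forall p, p \in l -> ~ U (Phi v p.1) p.2 w) /\
  forall j, j \in J -> ~ A j w /\ closure (A j `&` range (Phi v)) w.
have /choice [z zP] : forall lv : (seq (set nat * nat) * {set 'I_n}) * (nat -> X), exists z,
    (exists w, good lv.1.1 lv.1.2 lv.2 w) -> good lv.1.1 lv.1.2 lv.2 z.
  move=> [[l J] v] /=; case: (pselect (exists w, good l J v w)); first by move=> [w]; exists w.
  by move=> nw; exists x0 => /nw.
have [|Psi PsiP] := @small_hull X (set nat + seq (set nat * nat) * {set 'I_n}) (fun i v =>
    match i with
    | inl c => Phi v c
    | inr lJ => z (lJ, v)
    end).
  apply: small_sum small_set_nat _; apply: small_prod; last exact: small_countType.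
  by apply: small_seq; apply: small_prod small_set_nat _; exact: small_countType.
exists Psi => u; have [uN NF] := PsiP u.
have PhiN v : range v `<=` range (Psi u) -> range (Phi v) `<=` range (Psi u).
  by move=> vN _ [c _ <-]; exact: (NF (inl c) v vN).
split=> //.
  split=> [v c vN|x c Nx].
    by apply: (PhiN v vN); case: (PhiP v) => vPhi [+ _] _; apply.
  have xN : range (fun _ : nat => x) `<=` range (Psi u) by move=> _ [_ _ <-].
  apply: (PhiN _ xN); case: (PhiP (fun=> x)) => xPhi [_ +] _; apply.
  by apply: xPhi; exists 0.
move=> nu q qN s sN; pose v i := nth (u 0) s i.
have vN : range v `<=` range (Psi u).
  move=> _ [i _ <-]; have [si|si] := ltnP i (size s); first exact/sN/mem_nth.
  by rewrite /v nth_default //; apply: uN; exists 0.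
have [vPhi Phisat Phiesc] := PhiP v.
(* The hull of [v] contains [s] and lies in the new hull. The point [w], possibly outside both,
   shows that the request is satisfiable, so that [z] answers it inside the new hull. *)
have [||w wP [J [Jk JP]]] := escapes_reached _ Phisat Phiesc (nu := nu) (q := q).
- by exists (v 0); apply: vPhi; exists 0.
- by move=> y /(PhiN v vN); exact: qN.
have sPhi y : y \in s -> range (Phi v) y.
  by move=> ys; apply: vPhi; exists (index y s) => //; rewrite /v nth_index.
have /choice [d dP] : forall y, exists c, y \in s -> Phi v c = y.
  move=> y; have [/sPhi[c _ <-]|] := boolP (y \in s); last by exists set0.
  by exists c.
pose l := [seq (d y, nu y) | y <- s].
have [zl zJ] : good l J v (z (l, J, v)).
  apply: (zP (l, J, v)); exists w; split=> //.
  by move=> _ /mapP[y ys ->] /=; rewrite dP //; exact/wP/sPhi.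
exists (z (l, J, v)); split.
- exact: (NF (inr (l, J)) v vN).
- move=> y ys; have := zl (d y, nu y); rewrite /= dP //; apply.
  by apply/mapP; exists y.
- exists J; split=> // j /zJ[nA cl]; split=> //.
  by apply: closureS cl; apply: setIS; exact: PhiN.
Qed.

(** A point [q] outside the closure of a saturated [N] lies in none of the small G_deltas attached
    to points of [N], so each [y] in [N] has some [U y m] missing [q]. Escaping at level [n] then
    gives a point reached from [n + 1] pieces. *)
Lemma small_dense_of_cover : X -> exists D : set nat -> X, closure (range D) = [set: X].
Proof.
move=> x0; have [Phi /(_ (fun=> x0))] := escaping_hull n x0.
set N := range (Phi _); move=> [uN Nsat Nesc]; exists (Phi (fun=> x0)).
apply/seteqP; split=> // q _; apply: contrapT => nq.
have /choice [nu nuP] : forall y, exists m, N y -> ~ U y m q.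
  move=> y; have [Ny|nNy] := pselect (N y); last by exists 0.
  suff [m nU] : exists m, ~ U y m q by exists m.
  apply/existsNP => yq; apply: nq.
  have : closure (range (C y)) q by apply: UC => m _; exact: yq.
  by apply: closureS => _ [c _ <-]; case: Nsat => _; apply.
have [||z _] := @escapes_reached n N nu q _ Nsat Nesc.
- by exists x0; apply: uN; exists 0.
- exact: nuP.
- exact: reached_unbounded.
Qed.

End SmallDense.

(** * Homogeneous compacta *)

Section Homogeneous.
Context (X : topologicalType) (XX : compactum X) (Xhom : homogeneous_space X).

(** For a homeomorphism [h] taking [p] to [x], the open sets defining [G] are pulled back along its
    inverse and [C] is pushed forward along [h]. *)
Lemma homogeneous_small_cover (G : set X) (C : set nat -> X) :
  closed_Gdelta G -> G !=set0 -> G `<=` closure (range C) ->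
  exists (U : X -> nat -> set X) (D : X -> set nat -> X),
  [/\ forall x m, open (U x m), forall x m, U x m x &
    forall x, \bigcap_m U x m `<=` closure (range (D x))].
Proof.
move=> [_ [V [Vo GV]]] [p Gp] GC.
have /choice [UD UDP] : forall x, exists UD : (nat -> set X) * (set nat -> X),
    [/\ forall m, open (UD.1 m), forall m, UD.1 m x &
      \bigcap_m UD.1 m `<=` closure (range UD.2)].
  move=> x; have [h [[hc [g [gc hK gK]]] hx]] := Xhom p x.
  exists (fun m => g @^-1` V m, h \o C); split=> /=.
  - by move=> m; apply: open_comp => // y _; exact: gc.
  - by move=> m; rewrite /= -hx hK; move: Gp; rewrite GV; exact.
  - move=> y yV O yO; have := GC (g y); rewrite GV => /(_ yV (h @^-1` O)).
    case; first by apply: hc; rewrite gK.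
    by move=> _ [[c _ <-] Oc]; exists (h (C c)); split=> //; exists c.
by exists (fun x => (UD x).1), (fun x => (UD x).2); split=> x; case: (UDP x).
Qed.

(** Code [x] by picking, for each [m], a point [D (d m)] in the image of [B m] under a homeomorphism
    taking [p] to [x]. For distinct points some [m] puts the two images into disjoint open sets, so
    the codes differ. *)
Lemma homogeneous_small_of_pi_base (p : X) (D : set nat -> X) :
  countable_pi_base p -> closure (range D) = [set: X] -> small X.
Proof.
move=> [B [Bo Bp]] Ddense.
have /choice [h hP] : forall x, exists h : X -> X, homeomorphism h /\ h p = x.
  exact: Xhom.
have /choice [d dP] : forall x, exists d : nat -> set nat, forall m,
    exists2 b, B m b & h x b = D (d m).
  move=> x; suff /choice [d dP] : forall m, exists c, exists2 b, B m b & h x b = D c by exists d.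
  move=> m; have [[hc [g [gc hK gK]]] _] := hP x; have [Bmo [b Bb]] := Bo m.
  have : closure (range D) (h x b) by rewrite Ddense.
  case/(_ (g @^-1` B m)) => [|_ [[c _ <-] Bc]].
    by apply: gc; rewrite hK; exact: open_nbhs_nbhs.
  by exists c, (g (D c)).
apply: (small_injective (f := d)) (small_fun nat small_set_nat) => x y dxy.
apply: contrapT => /eqP xy.
have [[O1 O2]/=] : exists2 O : set X * set X, x \in O.1 /\ y \in O.2 &
    [/\ open O.1, open O.2 & O.1 `&` O.2 == set0].
  by move: XX.2; rewrite open_hausdorff => /(_ x y xy).
move=> [/set_mem O1x /set_mem O2y] [O1o O2o /eqP O120].
have [[hxc _] hxp] := hP x; have [[hyc _] hyp] := hP y.
have [m mO] : exists m, B m `<=` h x @^-1` O1 `&` h y @^-1` O2.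
  apply: Bp; apply: filterI; [apply: hxc; rewrite hxp|apply: hyc; rewrite hyp];
    exact: open_nbhs_nbhs.
have [b Bb bx] := dP x m; have [c Bc cy] := dP y m.
have : set0 (D (d x m)); last by [].
rewrite -O120; split; first by rewrite -bx; case: (mO b Bb).
by rewrite dxy -cy; case: (mO c Bc).
Qed.

(** An isolated point would make all points isolated by homogeneity, and compactness would make the
    space finite. *)
Lemma homogeneous_two_points (O : set X) : infinite_set [set: X] ->
  open O -> O !=set0 -> exists x y, [/\ O x, O y & x != y].
Proof.
move=> Xinf Oo [x Ox]; apply: contrapT => nO.
have O1 : O = [set x].
  apply/seteqP; split=> [y Oy|_ ->//]; apply: contrapT => /eqP yx.
  by apply: nO; exists y, x; split.
have Xo (y : X) : nbhs y [set y].
  have [h [[hc [g [gc hK gK]]] hx]] := Xhom y x.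
  have hO : nbhs y (h @^-1` O) by apply: hc; rewrite hx; exact: open_nbhs_nbhs.
  apply: filterS hO => z /=; rewrite O1 => hz.
  by rewrite /= -(hK z) -(hK y) hx hz.
have [s sP] := compact_finite_cover XX.1 Xo.
apply: Xinf; apply: sub_finite_set (finite_seq s) => z _.
by have [q qs ->] := sP z.
Qed.

(** Every nonempty open set contains two nonempty open sets with disjoint closures; iterating along
    binary sequences, compactness leaves a point on each branch. *)
Lemma homogeneous_Cantor_scheme : infinite_set [set: X] ->
  exists f : (nat -> bool) -> X, injective f.
Proof.
move=> Xinf.
pose good (O : set X) := open O /\ O !=set0.
have /choice [sp spP] : forall O, exists V : bool -> set X, good O ->
    [/\ forall b, good (V b), forall b, closure (V b) `<=` O &
      closure (V true) `&` closure (V false) = set0].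
  move=> O; have [[Oo One]|nO] := pselect (good O); last by exists (fun=> O) => /nO.
  have [x [y [Ox Oy xy]]] := homogeneous_two_points Xinf Oo One.
  have [[O1 O2]/=] : exists2 O : set X * set X, x \in O.1 /\ y \in O.2 &
      [/\ open O.1, open O.2 & O.1 `&` O.2 == set0].
    by move: XX.2; rewrite open_hausdorff => /(_ x y xy).
  move=> [/set_mem O1x /set_mem O2y] [O1o O2o /eqP O120].
  have shrink z Z : open Z -> Z z -> O z ->
      exists V, good V /\ closure V `<=` O `&` Z.
    move=> Zo Zz Oz.
    have [|V [Vo zV VO]] := compactum_shrink XX (compactum_closed1 XX (x:=z)) (openI Oo Zo).
      by move=> _ ->.
    by exists V; split=> //; split=> //; exists z; exact: zV.
  have [V1 [gV1 V1O]] := shrink x O1 O1o O1x Ox.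
  have [V2 [gV2 V2O]] := shrink y O2 O2o O2y Oy.
  exists (fun b => if b then V1 else V2) => _; split.
  - by case.
  - by case=> z; [move=> /V1O[]|move=> /V2O[]].
  - by rewrite -subset0 -O120 => z [/V1O[_ ?] /V2O[_ ?]].
pose V := fix V (s : nat -> bool) n := if n is m.+1 then sp (V s m) (s m) else setT.
have [x0 _] : [set: X] !=set0.
  by apply/set0P/eqP => X0; apply: Xinf; rewrite X0; exact: finite_set0.
have Vgood s m : good (V s m).
  elim: m => [|m IH] /=; first by split; [exact: openT|exists x0].
  by case: (spP _ IH) => + _ _; apply.
have Vdecr s m k : V s (m + k) `<=` V s m.
  elim: k => [|k IH]; rewrite ?addn0 // addnS => x xV; apply: IH.
  by case: (spP _ (Vgood s (m + k))) => _ /(_ (s (m + k)) x) + _; apply; exact: subset_closure.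
have /choice [f fP] : forall s, exists x, forall m, closure (V s m) x.
  move=> s; apply: (@directed_bigcap X XX.1 nat (fun m => closure (V s m)) 0).
  - by move=> m; exact: closed_closure.
  - by move=> m; have [_ [x Vx]] := Vgood s m; exists x; exact: subset_closure.
  - move=> i j; exists (i + j) => x xV.
    by split; apply: closureS xV; [|rewrite addnC]; exact: Vdecr.
exists f => s t fst; apply: contrapT => nst.
have [m mst] : exists m, s m != t m.
  apply: contrapT => nm; apply: nst; apply: funext => m.
  by apply/eqP; apply: contrapT => /negP sm; apply: nm; exists m.
(* Up to the first disagreement both branches share the same open set, whose two successors have
   disjoint closures. *)
have := ex_minnP (ex_intro (fun m => s m != t m) m mst).
case=> {mst}m mst mmin.
have VE : V s m = V t m.
  have agree k : (k < m)%N -> s k = t k.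
    by move=> km; apply/eqP; apply: contraLR km => /mmin; rewrite -leqNgt.
  elim: m agree {mst mmin} => //= m IH agree.
  by rewrite IH ?agree // => k km; apply: agree; exact: ltnW.
have := fP s m.+1; have := fP t m.+1; rewrite /= fst VE.
case: (spP _ (Vgood t m)) => _ _ V0.
suff : forall b c, b != c -> closure (sp (V t m) b) (f t) -> closure (sp (V t m) c) (f t) -> False.
  by move=> H ft fs; exact: H mst fs ft.
by case=> [] [] // _ h1 h2; have : set0 (f t); rewrite // -V0.
Qed.

End Homogeneous.

Lemma injective_card_le (S T : Type) (f : S -> T) :
  injective f -> [set: S] #<= [set: T].
Proof.
move=> fI; have /card_eqPle[_ le] := @inj_card_eq _ _ [set: S] f (in2W fI).
exact: card_le_trans le (card_leT _).
Qed.

Theorem theorem4p2 (X : topologicalType)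
    (Xinfinite : infinite_set [set: X])
    (Xhomogeneous : homogeneous_space X)
    (Xcompactum : compactum X)
    (n : nat) (A : 'I_n -> set X)
    (Acover : \bigcup_i A i = [set: X])
    (Atight : forall i, countably_tight_subspace (A i)) :
  [set: X] #= [set: set nat].
Proof.
have Xne : [set: X] !=set0.
  by apply/set0P/eqP => X0; apply: Xinfinite; rewrite X0; exact: finite_set0.
have [x0 _] := Xne.
have [p pB] := exists_countable_pi_base Xcompactum Acover Atight Xne.
have [G [C [dG Gne GC]]] := small_dense_Gdelta Xcompactum Acover Atight Xne.
have [U [E [Uo Ux UE]]] := homogeneous_small_cover Xhomogeneous dG Gne GC.
have [T TP] := separable_small_cover Xcompactum Uo Ux.
have [D Ddense] := small_dense_of_cover Xcompactum Acover Atight Uo UE TP x0.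
have [e eI] := homogeneous_small_of_pi_base Xcompactum Xhomogeneous pB Ddense.
have [f fI] := homogeneous_Cantor_scheme Xcompactum Xhomogeneous Xinfinite.
apply/card_eqPle; split; first exact: injective_card_le eI.
apply: (@injective_card_le _ _ (fun a : set nat => f (fun m => `[< a m >]))) => a b /fI ab.
apply/seteqP; split=> m; have /= := congr1 (fun g => g m) ab => abm /asboolP am; apply/asboolP.
  by rewrite -abm.
by rewrite abm.
Qed.
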